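(* Let $$\mathcal{S}=\{\overline{\mathbf{c}}\in\mathbb{R}^{|A|}:\ \mathbf{c}^{min}\le\overline{\mathbf{c}}\le\mathbf{c}^{max},\ \ \mathbf{B}\overline{\mathbf{c}}\le\mathbf{b}\},$$ where $\mathbf{c}^{min}=(c^{min}_a)_{a\in A}$ and $\mathbf{c}^{max}=(c^{max}_a)_{a\in A}$ are given by $$c^{min}_a=\min_{\mathbb{Q}_a\in\widetilde{\mathcal{Q}}_a}\mathbb{E}_{\mathbb{Q}_a}\{c_a\},\qquad c^{max}_a=\max_{\mathbb{Q}_a\in\widetilde{\mathcal{Q}}_a}\mathbb{E}_{\mathbb{Q}_a}\{c_a\}.$$ Then the distributionally robust shortest path problem $$\min_{\mathbf{y}\in Y}\ \max_{\mathbb{Q}\in\mathcal{Q}}\ \mathbb{E}_{\mathbb{Q}}\{\mathbf{c}^\top\mathbf{y}\}$$ is equivalent to the robust shortest path problem with polyhedral uncertainty $$\min_{\mathbf{y}\in Y}\ \max_{\overline{\mathbf{c}}\in\mathcal{S}}\ \sum_{a\in A}\overline{c}_a y_a,$$ i.e., the two problems have the same optimal value and the same optimal vectors $\mathbf{y}\in Y$.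
   Context: $G=(N,A)$ is a finite directed connected graph with source node $s\in N$ and destination node $t\in N$. For $i\in N$, $RS_i$ (resp. $FS_i$) is the set of arcs directed out of (resp. into) node $i$. Path-incidence vectors: $Y=\{\mathbf{y}\in\{0,1\}^{|A|}: \mathbf{G}\mathbf{y}=\mathbf{g}\}$, where $G_{ia}=1$ if $a\in RS_i$, $G_{ia}=-1$ if $a\in FS_i$, $G_{ia}=0$ otherwise, and $g_s=1$, $g_t=-1$, $g_i=0$ for all other nodes $i$. The arc cost vector $\mathbf{c}=(c_a)_{a\in A}$ is random with joint distribution $\mathbb{Q}$. $\mathcal{Q}_0(\mathbb{R}^k)$ denotes the set of all probability distributions on $\mathbb{R}^k$; $\mathbb{Q}_a$ denotes the marginal distribution of $c_a$ induced by $\mathbb{Q}$. For each arc $a\in A$ there are given a support interval $[l_a,u_a]$ with $0\le l_a\le u_a<\infty$, an index set $\mathcal{D}_a=\{1,\dots,D_a\}$, subintervals $[l^{(i)}_a,u^{(i)}_a]\subseteq[l_a,u_a]$ and numbers $0\le \underline{q}^{(i)}_a\le\overline{q}^{(i)}_a\le 1$, $i\in\mathcal{D}_a$. The last index $i=D_a$ is the support constraint: $l^{(D_a)}_a=l_a$, $u^{(D_a)}_a=u_a$, $\underline{q}^{(D_a)}_a=\overline{q}^{(D_a)}_a=1$. Moreover $\mathbf{B}\in\mathbb{R}^{D_0\times|A|}$ and $\mathbf{b}\in\mathbb{R}^{D_0}$ are given. The sets of distributions are $$\mathcal{Q}=\{\mathbb{Q}\in\mathcal{Q}_0(\mathbb{R}^{|A|}):\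 \mathbb{E}_{\mathbb{Q}}\{\mathbf{B}\mathbf{c}\}\le\mathbf{b};\ \mathbb{Q}_a\{c_a\in[l^{(i)}_a,u^{(i)}_a]\}\in[\underline{q}^{(i)}_a,\overline{q}^{(i)}_a]\ \ \forall i\in\mathcal{D}_a,\ a\in A\},$$ $$\widetilde{\mathcal{Q}}_a=\{\mathbb{Q}_a\in\mathcal{Q}_0(\mathbb{R}):\ \mathbb{Q}_a\{c_a\in[l^{(i)}_a,u^{(i)}_a]\}\in[\underline{q}^{(i)}_a,\overline{q}^{(i)}_a]\ \ \forall i\in\mathcal{D}_a\}.$$ Standing assumptions. A1: for each $a\in A$ there exists $\mathbb{Q}_a\in\widetilde{\mathcal{Q}}_a$ such that $\mathbb{Q}_a\{l^{(i)}_a\le c_a\le u^{(i)}_a\}\in(\underline{q}^{(i)}_a,\overline{q}^{(i)}_a)$ whenever $\underline{q}^{(i)}_a<\overline{q}^{(i)}_a$, $i\in\mathcal{D}_a$. A2: for each $a\in A$ and any pair $i_1,i_2\in\mathcal{D}_a$ we have $l^{(i_1)}_a\ne u^{(i_2)}_a$ and $l^{(i_2)}_a\ne u^{(i_1)}_a$. Vector inequalities are componentwise.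
   Formalization: The min and max defining c^min, c^max and the inner max are read as inf and sup, since they need not be attained under A1, A2; it is added that either all c^min_a, c^max_a are attained or the set 𝒬 is nonempty (otherwise 𝒬 can be empty while S is not). *)

(* Defs.v *)
(* MathComp-Analysis. *)
From HB Require Import structures.
From mathcomp Require Import all_boot all_order all_algebra.
From mathcomp Require Import all_classical all_reals all_analysis.

Set Implicit Arguments.
Unset Strict Implicit.
Unset Printing Implicit Defensive.

Import Order.TTheory GRing.Theory Num.Theory.
Import numFieldNormedType.Exports.

Local Open Scope classical_set_scope.
Local Open Scope ring_scope.

(* Nodes are 'I_k and arcs 'I_n.  Connectedness ignores arc directions.
   Parallel arcs and loops are allowed; in incidence a loop is outgoing. *)
Record digraph (k n : nat) := Digraph {
  tail : 'I_n -> 'I_k;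
  head : 'I_n -> 'I_k;
  digraph_connected : forall u v : 'I_k,
    connect [rel x y | [exists a, ((tail a == x) && (head a == y))
                               || ((tail a == y) && (head a == x))]] u v }.

Definition RS k n (N : digraph k n) (i : 'I_k) : {set 'I_n} :=
  [set a | tail N a == i]%SET.

Definition FS k n (N : digraph k n) (i : 'I_k) : {set 'I_n} :=
  [set a | head N a == i]%SET.

Definition incidence (R : realType) k n (N : digraph k n) : 'M[R]_(k, n) :=
  \matrix_(i, a) (if a \in RS N i then 1 else if a \in FS N i then -1 else 0).

Definition unit_flow (R : realType) k (s t : 'I_k) : 'cV[R]_k :=
  \col_i (if i == s then 1 else if i == t then -1 else 0).

Definition path_vectors (R : realType) k n (N : digraph k n) (s t : 'I_k) :
    set 'cV[R]_n :=
  [set y : 'cV[R]_n | (forall a, y a 0 = 0 \/ y a 0 = 1) /\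
           incidence R N *m y = unit_flow R s t].

Arguments path_vectors R {k n} N s t.

(* The constraints attached to one arc.  The index set {1, .., D} is encoded
   as 'I_ncon.+1 (so D = ncon + 1 >= 1), and its last index is ord_max. *)
Record arc_data (R : realType) := ArcData {
  supp_lo : R;
  supp_hi : R;
  ncon : nat;
  sub_lo : 'I_ncon.+1 -> R;
  sub_hi : 'I_ncon.+1 -> R;
  q_lo : 'I_ncon.+1 -> R;
  q_hi : 'I_ncon.+1 -> R;
  supp_range : 0 <= supp_lo <= supp_hi;
  sub_range : forall i,
    [/\ supp_lo <= sub_lo i, sub_lo i <= sub_hi i & sub_hi i <= supp_hi];
  q_range : forall i, [/\ 0 <= q_lo i, q_lo i <= q_hi i & q_hi i <= 1];
  last_con : [/\ sub_lo ord_max = supp_lo, sub_hi ord_max = supp_hi,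
                 q_lo ord_max = 1 & q_hi ord_max = 1] }.

Definition meets_constraints (R : realType) (d : arc_data R)
    (mu : set R -> \bar R) : Prop :=
  forall i : 'I_(ncon d).+1,
    ((q_lo i)%:E <= mu `[sub_lo i, sub_hi i]%classic <= (q_hi i)%:E)%E.

Definition marginal_set (R : realType) (d : arc_data R) :
    set (probability R R) :=
  [set P : probability R R | meets_constraints d P].

Definition cost_vec (R : realType) n (c : n.-tuple R) : 'cV[R]_n :=
  \col_a tnth c a.

(* R^n carries the product Borel sigma-algebra that the library puts on
   tuples; pushforward along the a-th coordinate is the a-th marginal. *)
Definition joint_set (R : realType) n m (d : 'I_n -> arc_data R)
    (B : 'M[R]_(m, n)) (b : 'cV[R]_m) : set (probability (n.-tuple R) R) :=
  [set Q : probability (n.-tuple R) R |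
        (forall j, ('E_Q[fun c => ((B *m cost_vec c) j 0)%R] <= (b j 0%R)%:E)%E)
        /\ (forall a, meets_constraints (d a)
                        (pushforward Q (fun c : n.-tuple R => tnth c a)))].

Definition strictly_feasible (R : realType) (d : arc_data R) : Prop :=
  exists2 P : probability R R, marginal_set d P &
    forall i : 'I_(ncon d).+1, q_lo i < q_hi i ->
      ((q_lo i)%:E < P `[sub_lo i, sub_hi i]%classic < (q_hi i)%:E)%E.

Definition separated_endpoints (R : realType) (d : arc_data R) : Prop :=
  forall i1 i2 : 'I_(ncon d).+1, i1 != i2 ->
    sub_lo i1 <> sub_hi i2 /\ sub_lo i2 <> sub_hi i1.

Definition mean_set (R : realType) (d : arc_data R) : set (\bar R) :=
  [set 'E_P[fun x : R => x]%E | P in marginal_set d].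

Definition cmin (R : realType) (d : arc_data R) : \bar R :=
  ereal_inf (mean_set d).

Definition cmax (R : realType) (d : arc_data R) : \bar R :=
  ereal_sup (mean_set d).

Definition mean_polyhedron (R : realType) n m (d : 'I_n -> arc_data R)
    (B : 'M[R]_(m, n)) (b : 'cV[R]_m) : set 'cV[R]_n :=
  [set c : 'cV[R]_n |
        (forall a, (cmin (d a) <= (c a 0%R)%:E <= cmax (d a))%E) /\
           (forall j, (B *m c) j 0 <= b j 0)].

Definition dr_objective (R : realType) n m (d : 'I_n -> arc_data R)
    (B : 'M[R]_(m, n)) (b : 'cV[R]_m) (y : 'cV[R]_n) : \bar R :=
  ereal_sup [set 'E_Q[fun c => (((cost_vec c)^T *m y) 0 0)%R]%E
            | Q in joint_set d B b].

Definition robust_objective (R : realType) n m (d : 'I_n -> arc_data R)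
    (B : 'M[R]_(m, n)) (b : 'cV[R]_m) (y : 'cV[R]_n) : \bar R :=
  ereal_sup [set (\sum_a c a 0 * y a 0)%:E | c in mean_polyhedron d B b].

Definition optimal_value (R : realType) T (Y : set T) (f : T -> \bar R) :
    \bar R :=
  ereal_inf [set f y | y in Y].

Definition optimal_solutions (R : realType) T (Y : set T) (f : T -> \bar R) :
    set T :=
  [set y | Y y /\ forall z, Y z -> (f y <= f z)%E].

Definition means_attained (R : realType) (d : arc_data R) : Prop :=
  mean_set d (cmin d) /\ mean_set d (cmax d).

(* cmin, cmax and the inner maxima are taken as infima and suprema because
   the probability constraints are not closed under weak limits.  With one
   arc, support [0, 1], Q([0, 1/2]) in [0, 1/2] and E c <= 1/4, cmin = 1/4 is
   not attained: no distribution is feasible, yet the polyhedron is {1/4}.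
   Either alternative below excludes this: the first says that cmin and cmax
   are a genuine minimum and maximum, the second that the inner maximum over
   distributions ranges over a nonempty set. *)
Definition well_posed (R : realType) n m (d : 'I_n -> arc_data R)
    (B : 'M[R]_(m, n)) (b : 'cV[R]_m) : Prop :=
  (forall a, means_attained (d a)) \/ joint_set d B b !=set0.

(* Main.v *)
(* For each y the two inner problems have the same value.  A feasible joint law
   has its mean vector in the polyhedron, and E[c^T y] depends on that mean
   vector only.  Conversely, if every coordinate of a point of the polyhedron is
   the mean of some feasible marginal, then the product of these marginals is a
   feasible joint law.  Sets of marginal means are convex, so every coordinate
   is such a mean when the extreme means are attained; when only a feasible
   joint law is known, moving the point slightly towards its mean vector makes
   the coordinates attainable, and the value is recovered in the limit. *)

Require Import Defs.
From HB Require Import structures.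
From mathcomp Require Import all_boot all_order all_algebra.
From mathcomp Require Import all_classical all_reals all_analysis.
From mathcomp Require Import measurable_realfun ring lra.

Set Implicit Arguments.
Unset Strict Implicit.
Unset Printing Implicit Defensive.

Import Order.TTheory GRing.Theory Num.Theory.

Local Open Scope classical_set_scope.
Local Open Scope ring_scope.

(** * Expectations of random variables with bounded support *)

Section bounded_random_variable.
Local Open Scope ereal_scope.
Context d (T : measurableType d) (R : realType) (P : probability T R).

Lemma probability_setC0 (A : set T) : measurable A -> P A = 1 -> P (~` A) = 0.
Proof. by move=> mA PA; rewrite probability_setC// PA subee. Qed.

(** The complement of the preimage of [[l, u]] is null, and on the preimage the constant [|l| + |u|]
    dominates [|X|]. *)
Lemma integrable_supported (X : T -> R) (l u : R) :
  measurable_fun setT X -> P (X @^-1` `[l, u]%classic) = 1 ->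
  P.-integrable setT (EFin \o X).
Proof.
move=> mX PX; have mI : measurable (X @^-1` `[l, u]%classic).
  by rewrite -[X in measurable X]setTI; exact: mX.
apply/integrableP; split; first exact/measurable_EFinP.
rewrite (@ge0_negligible_integral _ _ _ P _ (~` (X @^-1` `[l, u]%classic)))//.
- rewrite setDE setTI setCK.
  apply: (@le_lt_trans _ _
      (\int[P]_(x in X @^-1` `[l, u]%classic) (cst (`|l| + `|u|)%:E) x)).
    apply: ge0_le_integral => //.
    + by apply: measurableT_comp => //; apply/measurable_EFinP/measurable_funTS.
    + move=> x /=; rewrite in_itv/= lee_fin => /andP[lx xu].
      by rewrite ler_norml; have := ler_norm u; have := ler_norm (- l);
         have := normr_ge0 u; have := normr_ge0 l; rewrite normrN; lra.
  by rewrite integral_cst// [X in _ * X]PX mule1 ltry.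
- exact: measurableC.
- by apply: measurableT_comp => //; exact/measurable_EFinP.
- exact: probability_setC0.
Qed.

Lemma expectation_lincomb (I : finType) (w : I -> R) (X : I -> T -> R) :
  (forall i, P.-integrable setT (EFin \o X i)) ->
  'E_P[fun x => (\sum_i w i * X i x)%R] = (\sum_i w i * fine 'E_P[X i])%R%:E.
Proof.
move=> iX; rewrite unlock.
under eq_integral do rewrite -sumEFin.
rewrite integral_sum//; last first.
  move=> i; rewrite (_ : (fun x => (w i * X i x)%:E) =
    fun x => (w i)%:E * (EFin \o X i) x).
    exact: integrableZl.
  by [].
rewrite -sumEFin; apply: eq_bigr => i _.
under eq_integral do rewrite EFinM.
rewrite EFinM fineK; first by rewrite -integralZl//; exact: iX.
by apply: integrable_fin_num => //; exact: iX.
Qed.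

End bounded_random_variable.

(** * Convex combinations of two probability measures *)

Section mixture.
Local Open Scope ereal_scope.
Context d (T : measurableType d) (R : realType).
Variables (s t : {nonneg R}) (st1 : (s%:num + t%:num = 1)%R).
Variables (P1 P2 : probability T R).

(* The weight equation is a parameter so that the probability instance below
   can depend on it. *)
Definition mixture of (s%:num + t%:num = 1)%R : set T -> \bar R :=
  measure_add (mscale s P1) (mscale t P2).

HB.instance Definition _ := Measure.on (mixture st1).

Lemma mixtureE A : mixture st1 A = s%:num%:E * P1 A + t%:num%:E * P2 A.
Proof. exact: measure_addE. Qed.

Let mixture_setT : mixture st1 setT = 1.
Proof. by rewrite mixtureE !probability_setT !mule1 -EFinD st1. Qed.

HB.instance Definition _ :=
  Measure_isProbability.Build _ _ _ (mixture st1) mixture_setT.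

End mixture.

(** The independent coupling, by induction on [n]: the product of the first law with a coupling of
    the others is carried to tuples by cons. *)
Lemma exists_coupling (R : realType) d (T : measurableType d) n
    (P : 'I_n -> probability T R) (x0 : T) :
  exists Q : probability (n.-tuple T) R,
    forall a A, measurable A ->
      pushforward Q (fun c : n.-tuple T => tnth c a) A = P a A.
Proof.
elim: n P => [|n IHn] P.
  by exists (\d_ [tuple of [::]]) => -[].
have [Q HQ] := IHn (fun a => P (lift ord0 a)).
pose f (p : T * n.-tuple T) := [the n.+1.-tuple T of p.1 :: p.2].
have mf : measurable_fun setT f by exact: measurable_cons.
pose F := MeasurableFun.Pack
  (MeasurableFun.Class (isMeasurableFun.Build _ _ _ _ f mf)).
exists (distribution (P ord0 \x Q)%E F) => a A mA.
have mQ b : measurable ((fun c : n.-tuple T => tnth c b) @^-1` A).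
  by rewrite -[X in measurable X]setTI; exact: measurable_tnth.
rewrite /pushforward /distribution /pushforward/=.
case: (unliftP ord0 a) => [b|] -> /=.
  (* An event on one coordinate is a rectangle with one full side, so its product measure is that of
     the other side. *)
  rewrite [X in product_measure1 _ _ X](_ : _ =
      setT `*` ((fun c : n.-tuple T => tnth c b) @^-1` A)).
    rewrite product_measure1E// [X in (X * _)%E]probability_setT mul1e.
    exact: HQ.
  by apply/seteqP; split => [[x c]|[x c] []]/=; rewrite /f/= tnthS.
rewrite [X in product_measure1 _ _ X](_ : _ = A `*` setT).
  by rewrite product_measure1E// [X in (_ * X)%E]probability_setT mule1.
by apply/seteqP; split => [[x c]|[x c] []]/=.
Qed.

(** * Convexity of the set of feasible means of one arc *)

Section marginal_means.
Context (R : realType) (d : arc_data R).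
Let I := `[supp_lo d, supp_hi d]%classic : set R.

Let measurable_I : measurable I.
Proof. exact: measurable_itv. Qed.

Lemma meets_constraints_support (mu : set R -> \bar R) :
  meets_constraints d mu -> mu I = 1%E.
Proof.
move=> /(_ ord_max); have [-> -> -> ->] := last_con d.
by rewrite -eq_le => /eqP.
Qed.

Lemma marginal_integrable (P : probability R R) :
  marginal_set d P -> P.-integrable setT (fun x : R => x%:E).
Proof. by move=> /meets_constraints_support; exact: integrable_supported. Qed.

(** On [I] the integrand is nonnegative, so the integral becomes additive in the measure;
    [mean_set_mixture] relies on this. *)
Lemma marginal_expectation (P : probability R R) : marginal_set d P ->
  'E_P[fun x : R => x]%E = (\int[P]_(x in I) x%:E)%E.
Proof.
move=> dP; rewrite unlock.
rewrite (@negligible_integral _ _ _ P _ (~` I))//.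
- by rewrite setDE setTI setCK.
- exact: measurableC.
- exact: marginal_integrable.
- by apply: probability_setC0 => //; exact: meets_constraints_support.
Qed.

Lemma mean_set_fin x : mean_set d x -> x \is a fin_num.
Proof.
move=> [P dP <-]; rewrite unlock; apply: integrable_fin_num => //.
exact: marginal_integrable.
Qed.

(** The constraints bound probabilities of fixed intervals, hence are preserved by mixing, and the
    mean is linear in the law. *)
Lemma mean_set_mixture (s t : {nonneg R}) x y : s%:num + t%:num = 1 ->
  mean_set d x%:E -> mean_set d y%:E ->
  mean_set d (s%:num * x + t%:num * y)%:E.
Proof.
move=> st1 [P dP EP] [Q dQ EQ].
have dPQ : marginal_set d (mixture P Q st1).
  move=> i /=; rewrite mixtureE.
  have /andP[Pl Pu] := dP i; have /andP[Ql Qu] := dQ i.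
  apply/andP; split.
    rewrite (_ : q_lo i = s%:num * q_lo i + t%:num * q_lo i); last first.
      by rewrite -mulrDl st1 mul1r.
    by rewrite EFinD !EFinM leeD// lee_wpmul2l// lee_fin.
  rewrite (_ : q_hi i = s%:num * q_hi i + t%:num * q_hi i); last first.
    by rewrite -mulrDl st1 mul1r.
  by rewrite EFinD !EFinM leeD// lee_wpmul2l// lee_fin.
exists (mixture P Q st1) => //.
have I0 (x' : R) : I x' -> (0 <= x'%:E)%E.
  rewrite /I/= in_itv/= lee_fin => /andP[+ _]; apply: le_trans.
  by have /andP[] := supp_range d.
have mI : measurable_fun I (fun x : R => x%:E) by exact/measurable_EFinP.
rewrite marginal_expectation// ge0_integral_measure_add//.
rewrite !ge0_integral_mscale//.
by rewrite -!marginal_expectation// EP EQ.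
Qed.

Lemma mean_set_between x y z :
  mean_set d x%:E -> mean_set d z%:E -> x <= y <= z -> mean_set d y%:E.
Proof.
move=> dx dz /andP[xy yz]; have [xz|] := ltP x z; last first.
  by move=> zx; rewrite (_ : y = x)//; apply/le_anti; rewrite xy (le_trans yz).
have zx0 : 0 < z - x by rewrite subr_gt0.
(* The mixing weights are the barycentric coordinates of [y] with respect to [x] and [z]. *)
have s0 : 0 <= (z - y) / (z - x) by rewrite divr_ge0 ?subr_ge0// ltW.
have t0 : 0 <= (y - x) / (z - x) by rewrite divr_ge0 ?subr_ge0// ltW.
rewrite (_ : y = (z - y) / (z - x) * x + (y - x) / (z - x) * z); last first.
  by field; rewrite gt_eqF.
apply: (@mean_set_mixture (NngNum s0) (NngNum t0)) => //=.
by field; rewrite gt_eqF.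
Qed.

Lemma mean_set_attained x : means_attained d ->
  (cmin d <= x%:E <= cmax d)%E -> mean_set d x%:E.
Proof.
move=> [dmin dmax].
rewrite -(fineK (mean_set_fin dmin)) -(fineK (mean_set_fin dmax)) !lee_fin.
by apply: mean_set_between; rewrite fineK// mean_set_fin.
Qed.

(** If [x] differs from [x0], the moved point [y] lies strictly inside the bound on the side of [x].
    Some feasible mean then lies beyond [y] on that side even if the bound is not attained, and [y]
    is between it and [x0]. *)
Lemma mean_set_shrink (e x0 x : R) : 0 < e -> e < 1 -> mean_set d x0%:E ->
  (cmin d <= x%:E <= cmax d)%E -> mean_set d ((1 - e) * x + e * x0)%:E.
Proof.
move=> e0 e1 dx0 /andP[cx xc]; set y := _ + _.
have [xx0|x0x|xx0] := ltgtP x x0.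
- have : (cmin d < y%:E)%E.
    by apply: (le_lt_trans cx); rewrite lte_fin /y; nra.
  move=> /ereal_inf_lt[z dz]; rewrite -(fineK (mean_set_fin dz)) lte_fin => zy.
  apply: (mean_set_between (x := fine z) (z := x0)) => //.
    by rewrite fineK// mean_set_fin.
  by rewrite (ltW zy)/= /y; nra.
- have : (y%:E < cmax d)%E.
    by apply: (lt_le_trans _ xc); rewrite lte_fin /y; nra.
  move=> /ereal_sup_gt[z dz]; rewrite -(fineK (mean_set_fin dz)) lte_fin => yz.
  apply: (mean_set_between (x := x0) (z := fine z)) => //.
    by rewrite fineK// mean_set_fin.
  by rewrite (ltW yz)/= /y andbT; nra.
- by rewrite (_ : y = x0)// /y xx0; ring.
Qed.

End marginal_means.

(** * Mean vectors of joint laws with feasible marginals *)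

Section joint_means.
Context (R : realType) (n : nat) (d : 'I_n -> arc_data R).

Definition mean_vec (Q : probability (n.-tuple R) R) : 'cV[R]_n :=
  \col_a fine 'E_Q[fun c => tnth c a]%E.

Definition feasible_marginals (Q : probability (n.-tuple R) R) := forall a,
  meets_constraints (d a) (pushforward Q (fun c : n.-tuple R => tnth c a)).

(** Packaging the projection as a measurable function lets [distribution] deliver the marginal as a
    probability. *)
Let coord (a : 'I_n) : {mfun (n.-tuple R) >-> R} :=
  MeasurableFun.Pack (MeasurableFun.Class
    (isMeasurableFun.Build _ _ (n.-tuple R) R _ (measurable_tnth a))).

Let integrable_tnth (Q : probability (n.-tuple R) R) a :
  feasible_marginals Q ->
  Q.-integrable setT (EFin \o (fun c : n.-tuple R => tnth c a)).
Proof.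
move=> /(_ a)/meets_constraints_support; apply: integrable_supported.
exact: measurable_tnth.
Qed.

Lemma expectation_mean_vec (Q : probability (n.-tuple R) R) (w : 'I_n -> R) :
  feasible_marginals Q ->
  'E_Q[fun c => (\sum_a w a * tnth c a)%R]%E = (\sum_a w a * mean_vec Q a 0)%:E.
Proof.
move=> dQ; rewrite expectation_lincomb; last first.
  by move=> a; exact: integrable_tnth.
by under [in RHS]eq_bigr do rewrite mxE.
Qed.

Lemma mean_vec_marginal (Q : probability (n.-tuple R) R) a
    (P : probability R R) : feasible_marginals Q ->
  (forall A, measurable A ->
     pushforward Q (fun c : n.-tuple R => tnth c a) A = P A) ->
  (mean_vec Q a 0)%:E = ('E_P[fun x : R => x])%E.
Proof.
move=> dQ QP; rewrite mxE unlock fineK; last first.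
  by apply: integrable_fin_num => //; exact: integrable_tnth.
transitivity (\int[distribution Q (coord a)]_x x%:E)%E.
  by rewrite integral_distribution//; exact: integrable_tnth.
by apply: eq_measure_integral => A mA _; exact: QP.
Qed.

Lemma mean_vec_mean_set (Q : probability (n.-tuple R) R) a :
  feasible_marginals Q -> mean_set (d a) (mean_vec Q a 0)%:E.
Proof.
move=> dQ.
exists (distribution Q (coord a)); first exact: dQ.
by rewrite -(@mean_vec_marginal Q a).
Qed.

(** Both the feasibility required here and the mean vector depend on the marginals only, so
    marginals can be chosen arc by arc and then coupled. *)
Lemma exists_joint (c : 'cV[R]_n) : (forall a, mean_set (d a) (c a 0)%:E) ->
  exists2 Q, feasible_marginals Q & mean_vec Q = c.
Proof.
move=> dc; have /boolp.choice[P dP] a : exists P : probability R R,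
    marginal_set (d a) P /\ 'E_P[fun x : R => x]%E = (c a 0)%:E.
  by have [P dP EP] := dc a; exists P.
have [Q QP] := exists_coupling P 0.
have dQ : feasible_marginals Q.
  by move=> a i; rewrite QP//; have [+ _] := dP a; exact.
exists Q => //; apply/matrixP => a j; rewrite ord1; apply: EFin_inj.
by rewrite (mean_vec_marginal dQ (QP a)); have [] := dP a.
Qed.

End joint_means.

(** The passage to the limit [e -> 0], made explicit: if [z < u], one small [e] already gives a
    contradiction. *)
Lemma lee_segment (R : realType) (z : \bar R) (u v : R) :
  (forall e, 0 < e -> e < 1 -> (((1 - e) * u + e * v)%:E <= z)%E) ->
  (u%:E <= z)%E.
Proof.
case: z => [z| |] zge; last 2 first.
- by rewrite leey.
- by have := zge (1 / 2); rewrite !leeNy_eq; apply; lra.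
rewrite lee_fin leNgt; apply/negP => zu.
have k0 : 0 < 2 * (`|u - v| + (u - z)).
  by have := normr_ge0 (u - v); lra.
(* With this [e] the move from [u] towards [v] has length [e * |u - v| < (u - z) / 2], so it stays
   above [z]. The summand [u - z] keeps the denominator positive when [u = v] and forces [e < 1]. *)
pose e := (u - z) / (2 * (`|u - v| + (u - z))).
have e0 : 0 < e by rewrite divr_gt0// subr_gt0.
have ek : e * (2 * (`|u - v| + (u - z))) = u - z by rewrite divfK// gt_eqF.
have e1 : e < 1.
  by rewrite ltr_pdivrMr//; have := normr_ge0 (u - v); lra.
have := zge _ e0 e1; rewrite lee_fin leNgt => /negP; apply.
have := ler_norm (u - v).
by nra.
Qed.

(** * Equality of the two inner maxima *)

Section objectives.
Context (R : realType) (n m : nat) (d : 'I_n -> arc_data R).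
Context (B : 'M[R]_(m, n)) (b : 'cV[R]_m).

Let expectation_constraint (Q : probability (n.-tuple R) R) j :
  'E_Q[fun c => ((B *m cost_vec c) j 0)%R]%E =
  'E_Q[fun c => (\sum_a B j a * tnth c a)%R]%E.
Proof.
congr expectation; apply/funext => c; rewrite mxE.
by under eq_bigr do rewrite mxE.
Qed.

Let expectation_cost (Q : probability (n.-tuple R) R) (y : 'cV[R]_n) :
  'E_Q[fun c => (((cost_vec c)^T *m y) 0 0)%R]%E =
  'E_Q[fun c => (\sum_a y a 0 * tnth c a)%R]%E.
Proof.
congr expectation; apply/funext => c; rewrite mxE.
by apply: eq_bigr => a _; rewrite !mxE mulrC.
Qed.

Lemma joint_set_mean_vec (Q : probability (n.-tuple R) R) :
  joint_set d B b Q -> mean_polyhedron d B b (mean_vec Q).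
Proof.
move=> [BQ dQ]; split=> [a|j].
  have dQa := mean_vec_mean_set a dQ.
  by rewrite ereal_inf_lbound//= ereal_sup_ubound.
by rewrite -lee_fin mxE -(expectation_mean_vec _ dQ) -expectation_constraint.
Qed.

Lemma dr_objective_ge (c y : 'cV[R]_n) :
  (forall a, mean_set (d a) (c a 0)%:E) -> (forall j, (B *m c) j 0 <= b j 0) ->
  ((\sum_a c a 0 * y a 0)%:E <= dr_objective d B b y)%E.
Proof.
move=> /exists_joint[Q dQ <-] Bc; apply: ereal_sup_ubound.
exists Q; first split=> // j.
  rewrite expectation_constraint (expectation_mean_vec _ dQ) lee_fin.
  by have := Bc j; rewrite mxE.
rewrite expectation_cost (expectation_mean_vec _ dQ).
by under eq_bigr do rewrite mulrC.
Qed.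

Lemma dr_objective_le_robust (y : 'cV[R]_n) :
  (dr_objective d B b y <= robust_objective d B b y)%E.
Proof.
apply: ge_ereal_sup => _ [Q dQ <-]; apply: ereal_sup_ubound.
exists (mean_vec Q); first exact: joint_set_mean_vec.
rewrite expectation_cost (expectation_mean_vec _ dQ.2).
by under eq_bigr do rewrite mulrC.
Qed.

Lemma dr_objective_eq_robust (y : 'cV[R]_n) : well_posed d B b ->
  dr_objective d B b y = robust_objective d B b y.
Proof.
move=> wp; apply/le_anti; rewrite dr_objective_le_robust/=.
apply: ge_ereal_sup => _ [c [dc Bc] <-].
case: wp => [att|[Q dQ]].
  by apply: dr_objective_ge => // a; exact: mean_set_attained.
have [_ BQ] := joint_set_mean_vec dQ.
apply: (lee_segment (v := \sum_a mean_vec Q a 0 * y a 0)) => e e0 e1.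
rewrite !mulr_sumr -big_split/=.
(* Both endpoints satisfy the linear constraints, hence so does [ce]; its coordinates are feasible
   means by [mean_set_shrink]. *)
pose ce := (1 - e) *: c + e *: mean_vec Q.
rewrite (eq_bigr (fun a => ce a 0 * y a 0)); last first.
  by move=> a _; rewrite !mxE; ring.
apply: dr_objective_ge => [a|j].
  rewrite [ce _ _]mxE [X in X + _]mxE [X in _ + X]mxE.
  by apply: mean_set_shrink => //; apply: mean_vec_mean_set; have [] := dQ.
rewrite mulmxDr -!scalemxAr [leLHS]mxE [X in X + _]mxE [X in _ + X]mxE.
by have := Bc j; have := BQ j; nra.
Qed.

End objectives.

Theorem theorem2 (R : realType) (k n m : nat) (N : digraph k n)
    (s t : 'I_k) (d : 'I_n -> arc_data R)
    (B : 'M[R]_(m, n)) (b : 'cV[R]_m)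
    (A1 : forall a, strictly_feasible (d a))
    (A2 : forall a, separated_endpoints (d a))
    (wp : well_posed d B b) :
  let Y := path_vectors R N s t in
  optimal_value Y (dr_objective d B b)
    = optimal_value Y (robust_objective d B b) /\
  optimal_solutions Y (dr_objective d B b)
    = optimal_solutions Y (robust_objective d B b).
Proof.
have -> : dr_objective d B b = robust_objective d B b.
  by apply/funext => y; exact: dr_objective_eq_robust.
by [].
Qed.
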